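(* Let $k\ge 2$, $n\ge 0$, and let $p$ be a prime. Then $$a_{1,k}(n)=\sum_{i\ge 1}\binom{i-1}{k-1}\mathfrak p(n-i)\quad\text{and}\quad a_{p,k}(n)=\sum_{i,j\ge 1}\binom{i-1}{k-2}\mathfrak p(n-i-pj).$$
   Context: A partition of $n$ is a weakly decreasing finite sequence of positive integers summing to $n$; $\mathcal P(n)$ is the set of partitions of $n$, and $\mathfrak p(n)=|\mathcal P(n)|$, with $\mathfrak p(0)=1$ and $\mathfrak p(m)=0$ for $m<0$. For a partition $\lambda$ and positive integer $i$, $m_\lambda(i)$ is the number of parts equal to $i$. For $\lambda=(\lambda_1,\ldots,\lambda_\ell)$ with $\ell\ge k$, $\mathrm{pre}_k(\lambda)$ is the partition whose parts are the $\binom{\ell}{k}$ products $\lambda_{i_1}\cdots\lambda_{i_k}$ over all $1\le i_1<\cdots<i_k\le\ell$ (with multiplicity); it is undefined if $\ell<k$. $\mathrm{pre}_k(\mathcal P(n))$ is the set of $\mathrm{pre}_k(\lambda)$ for $\lambda\in\mathcal P(n)$ with at least $k$ parts, and $a_{i,k}(n)=\sum_{\nu\in\mathrm{pre}_k(\mathcal P(n))} m_\nu(i)$. *)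

(* Defs.v *)
From HB Require Import structures.
From mathcomp Require Import all_boot all_order all_algebra.
From mathcomp Require Import finmap.
From mathcomp Require Import boolp classical_sets functions cardinality fsbigop.

Set Implicit Arguments.
Unset Strict Implicit.
Unset Printing Implicit Defensive.

Local Open Scope classical_set_scope.
Local Open Scope nat_scope.

Definition is_partition (n : nat) (la : seq nat) : bool :=
  [&& sorted geq la, all (leq 1) la & sumn la == n].

Definition partitions (n : nat) : set (seq nat) :=
  [set la | is_partition n la].

Definition mult (la : seq nat) (i : nat) : nat := count_mem i la.

(* Set to 0 at negative integers; fset_set A lists a finite set A, and is
   empty if A is infinite, which finite_partitions below rules out. *)
Definition num_partitions (m : int) : nat :=
  if m is Posz n then #|` fset_set (partitions n)| else 0.

(* One part for each k-element set A of positions of la, listed in weakly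
   decreasing order. When size la < k the value is the junk nil; pre_set
   leaves those la out. *)
Definition pre (k : nat) (la : seq nat) : seq nat :=
  sort geq [seq \prod_(i in A) nth 0 la i
           | A : {set 'I_(size la)} in [pred A : {set 'I_(size la)} | #|A| == k]].

Definition pre_set (k n : nat) : set (seq nat) :=
  pre k @` [set la | partitions n la /\ k <= size la].

(* The sum ranges over a set, so a partition that is pre k la for several
   la is counted once. Sums \big[addn/0]_(x \in A) F x over a classical set
   have their usual value when finitely many terms are nonzero. *)
Definition a_ (i k n : nat) : nat :=
  \big[addn/0]_(nu \in pre_set k n) mult nu i.

Lemma finite_partitions (n : nat) : finite_set (partitions n).
Proof.
pose f (t : n.-bseq 'I_n.+1) := [seq val x | x <- t].
apply: (@sub_finite_set _ _ (f @` [set: n.-bseq 'I_n.+1])); last first.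
  by apply: finite_image; exact: finite_finset.
move=> la /and3P[_ la1 /eqP lan].
have hs : size la <= n.
  rewrite -lan; elim: la la1 {lan} => //= x s IHs /andP[x1 /IHs h].
  by rewrite -add1n leq_add.
have hx x : x \in la -> x < n.+1.
  rewrite ltnS -lan; elim: la {la1 lan hs} => //= y s IHs.
  rewrite inE => /orP[/eqP->|/IHs h]; first exact: leq_addr.
  exact: leq_trans h (leq_addl _ _).
have hs' : size [seq (inord x : 'I_n.+1) | x <- la] <= n by rewrite size_map.
exists (Bseq hs') => //=.
rewrite /f /= -map_comp -[RHS]map_id.
by apply/eq_in_map => x /hx xn /=; rewrite inordK.
Qed.

Lemma finite_pre_set (k n : nat) : finite_set (pre_set k n).
Proof.
apply: finite_image; apply: (sub_finite_set _ (finite_partitions n)).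
by move=> la [].
Qed.

Lemma num_partitions0 : num_partitions 0%:Z = 1.
Proof.
have -> : num_partitions 0%:Z = #|` fset_set (partitions 0)| by [].
suff -> : partitions 0 = [set [::]] by rewrite fset_set1 cardfs1.
apply/seteqP; split=> [[|x s]|_ ->] //=.
by move=> /and3P[_ /andP[x0 _]] /=; rewrite addn_eq0; case: x x0.
Qed.

(* Main.v *)
(* The map pre k is not injective on partitions (the partitions 6+6+1 and 9+2+2 of
   13 have the same image under pre 3), but it is injective on the partitions
   with at least k-1 parts equal to 1, and those are the only ones whose image
   contains 1 or a prime. Hence a_ i k n, for i = 1 or i prime, is a sum over
   partitions: a product of k parts is 1 iff all the parts are 1, and it is p iff
   one part is p and the others are 1, which gives the summands C(m(1), k) and
   C(m(1), k-1) m(p). Expanding C(a, k) as the sum of C(i-1, k-1) over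
   1 <= i <= a and m(p) as the number of 1 <= j <= m(p), and exchanging sums,
   it remains to count the partitions of n with at least i ones and j parts p;
   removing those parts shows that there are p(n - i - pj) of them. *)

Require Import Defs.
From HB Require Import structures.
From mathcomp Require Import all_boot all_order all_algebra.
From mathcomp Require Import finmap.
From mathcomp Require Import boolp classical_sets functions cardinality fsbigop.
From mathcomp Require Import zify.

Set Implicit Arguments.
Unset Strict Implicit.
Unset Printing Implicit Defensive.

Local Open Scope classical_set_scope.
Local Open Scope nat_scope.

(** * Products of [k] entries of a list, by recursion *)

(** The same multiset of products as [pre k], in a form suited to induction: products using the head
    come first, then those avoiding it. *)
Fixpoint kprods (k : nat) (l : seq nat) : seq nat :=
  match k, l with
  | 0, _ => [:: 1]
  | k'.+1, [::] => [::]
  | k'.+1, y :: s => [seq y * z | z <- kprods k' s] ++ kprods k s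
  end.

Lemma kprods_cons k y s :
  kprods k.+1 (y :: s) = [seq y * z | z <- kprods k s] ++ kprods k.+1 s.
Proof. by []. Qed.

Lemma kprods0 l : kprods 0 l = [:: 1].
Proof. by case: l. Qed.

Lemma kprods_nil k l : size l < k -> kprods k l = [::].
Proof.
elim: l k => [|y s IHs] [|k] //= sk.
by rewrite !IHs // ltnW.
Qed.

(** Subsets containing the head [i] are [i |: B] with [B] inside [s]; the others lie in [s]. The
    weight [F] is arbitrary because the induction replaces it by [F (f i * _)]. *)
Lemma sum_kprods (T : finType) (f : T -> nat) (F : nat -> nat) k (s : seq T) :
  uniq s ->
  \sum_(A : {set T} | (A \subset s) && (#|A| == k)) F (\prod_(i in A) f i) =
  \sum_(y <- kprods k (map f s)) F y.
Proof.
elim: s k F => [|i s IHs] k F /=.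
  move=> _; case: k => [|k] /=.
    rewrite big_seq1 (big_pred1 finset.set0) ?big_set0 // => A.
    rewrite cards_eq0 /=; case: eqP => [->|_]; rewrite ?andbF ?andbT //.
    by apply/fintype.subsetP=> x; rewrite inE.
  rewrite big_nil big_pred0 // => A; apply/negP=> /andP[sA /eqP cA].
  have /card_gt0P[x xA]: 0 < #|A| by rewrite cA.
  by have /= := fintype.subsetP sA _ xA; rewrite in_nil.
case: k => [|k] /andP[i_s us].
  rewrite big_seq1 (big_pred1 finset.set0) ?big_set0 // => A.
  rewrite cards_eq0 /=; case: eqP => [->|_]; rewrite ?andbF ?andbT //.
  by apply/fintype.subsetP=> x; rewrite inE.
rewrite big_cat big_map -(IHs _ (fun z => F (f i * z))) // -IHs //.
rewrite (bigID (fun A : {set T} => i \in A)) /=; congr addn.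
  rewrite (reindex_onto (fun B : {set T} => i |: B)%SET
                        (fun A : {set T} => A :\ i)%SET) /=; last first.
    by move=> A /andP[_ iA]; rewrite finset.setD1K.
  have subs_i (B : {set T}) : B \subset s -> i \notin B.
    by move=> /fintype.subsetP sB; apply/negP=> /sB; rewrite (negPf i_s).
  apply: eq_big => [B|B /andP[/andP[/andP[_ _] _] /eqP eB]]; last first.
    by rewrite big_setU1 // -eB !inE eqxx.
  rewrite finset.setU11 andbT; apply/idP/idP.
    case/andP=> /andP[/fintype.subsetP sB cB] /eqP eB.
    have iB : i \notin B by rewrite -eB !inE eqxx.
    move: cB; rewrite finset.cardsU1 iB add1n eqSS => ->; rewrite andbT.
    apply/fintype.subsetP=> x xB; have := sB x; rewrite !inE xB orbT => /(_ isT).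
    by case/orP=> // /eqP xi; rewrite -xi xB in iB.
  case/andP=> sB /eqP cB; have iB := subs_i _ sB.
  rewrite finset.setU1K // eqxx finset.cardsU1 iB cB add1n eqxx !andbT.
  apply/fintype.subsetP=> x; rewrite !inE => /orP[->//|xB].
  by rewrite (fintype.subsetP sB _ xB) orbT.
apply: eq_bigl => A; rewrite -andbA [_ && (i \notin A)]andbC andbA; congr andb.
apply/andP/idP=> [[/fintype.subsetP sA iA]|/fintype.subsetP sA].
  apply/fintype.subsetP=> x xA; have := sA x xA; rewrite inE => /orP[/eqP xi|//].
  by rewrite -xi xA in iA.
split; last by apply/negP=> /sA; rewrite (negPf i_s).
by apply/fintype.subsetP=> x /sA xs; rewrite inE xs orbT.
Qed.

Lemma pre_kprods k la : perm_eq (pre k la) (kprods k la).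
Proof.
apply/permP => P; rewrite /pre.
rewrite (permP (permEl (perm_sort _ _))).
have [us es] : uniq (enum 'I_(size la)) /\
    [seq nth 0 la (i : 'I_(size la)) | i <- enum 'I_(size la)] = la.
  split; first exact: enum_uniq.
  by rewrite (map_comp (nth 0 la) val) val_enum_ord -/(mkseq _ _) mkseq_nth.
(* With the indicator of [P] as weight, the sum identity becomes an equality of counts. *)
have := sum_kprods (fun i : 'I_(size la) => nth 0 la i) (fun y => P y : nat) k us.
rewrite es => h; rewrite -!sum1_count big_image_cond [RHS]big_mkcond -h big_mkcondr.
apply: eq_bigl => A; rewrite inE.
have -> : A \subset enum 'I_(size la) by apply/fintype.subsetP=> x; rewrite mem_enum.
by [].
Qed.

(** * Multiplicities of 1 and of primes among the products *)

Lemma count_mulr_map y x L : 0 < y ->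
  count_mem (y * x) [seq y * z | z <- L] = count_mem x L.
Proof.
by move=> y0; rewrite count_map; apply: eq_count => z /=; rewrite eqn_pmul2l.
Qed.

Lemma count_mul_map_eq0 y x L : ~~ (y %| x) ->
  count_mem x [seq y * z | z <- L] = 0.
Proof.
move=> yx; apply/eqP; rewrite -leqn0 leqNgt -has_count; apply/negP.
by move=> /hasP[_ /mapP[z _ ->]] /eqP e; rewrite -e dvdn_mulr in yx.
Qed.

(** A head equal to 1 gives Pascal's rule; any other head does not divide 1. *)
Lemma count1_kprods k l : count_mem 1 (kprods k l) = 'C(count_mem 1 l, k).
Proof.
elim: l k => [|y s IHs] [|k] //; first by rewrite /= bin0.
rewrite kprods_cons count_cat IHs /=.
have [->|y1] := eqVneq y 1.
  by rewrite -[X in count_mem X](muln1 1) count_mulr_map // IHs add1n binS addnC.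
by rewrite count_mul_map_eq0 // dvdn1.
Qed.

(** A head 1 gives Pascal's rule again, a head [p] must be completed by [k] ones, and any other head
    does not divide [p]. *)
Lemma count_prime_kprods p k l : prime p ->
  count_mem p (kprods k.+1 l) = 'C(count_mem 1 l, k) * count_mem p l.
Proof.
move=> pp; have p1 : 1 == p = false by case: p pp => [|[|]].
elim: l k => [|y s IHs] k; first by rewrite muln0.
rewrite kprods_cons count_cat IHs /=.
have [->|y1] := eqVneq y 1.
  rewrite -{1}[p]mul1n count_mulr_map // p1 add0n add1n.
  case: k => [|k]; first by rewrite kprods0 !bin0 /= p1.
  by rewrite IHs binS mulnDl addnC.
have [->|yp] := eqVneq y p.
  rewrite -{1}[p]muln1 count_mulr_map ?prime_gt0 // count1_kprods.
  by rewrite add0n mulnDr muln1.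
rewrite count_mul_map_eq0 //; apply/negP=> yd.
by move: (primeP pp) => [_ /(_ _ yd)]; rewrite (negPf y1) (negPf yp).
Qed.

(* A factor that is at least x can occur in a product equal to x only if it is
   x itself and all the other factors are 1. *)
Lemma count_kprods_cat x k s c : 1 < x -> all (leq x) s ->
  count_mem x (kprods k.+1 (s ++ c)) =
  'C(count_mem 1 c, k) * count_mem x s + count_mem x (kprods k.+1 c).
Proof.
move=> x1; elim: s => [|y s IHs]; first by rewrite muln0.
case/andP=> xy xs; rewrite cat_cons kprods_cons count_cat IHs //= addnA mulnDr.
congr (_ + _ + _).
have [<-|yx] := eqVneq y x.
  have x0 : 0 < y by lia.
  rewrite -{1}[y]muln1 count_mulr_map // count1_kprods muln1 count_cat.
  rewrite (_ : count_mem 1 s = 0) //; apply/eqP; rewrite -leqn0 leqNgt -has_count.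
  by apply/hasPn=> z /(allP xs) /=; lia.
rewrite muln0 count_mul_map_eq0 //; apply/negP=> /dvdn_leq; lia.
Qed.

(** * Injectivity of [pre] on partitions with enough ones *)

Lemma sorted_geq_split x l : sorted geq l ->
  l = [seq y <- l | x <= y] ++ [seq y <- l | y < x].
Proof.
elim: l => //= y s IHs ys; have ss := path_sorted ys.
case: leqP => xy /=; first by rewrite -IHs.
have sx : all (fun z => z < x) s.
  apply/allP=> z zs; apply: leq_ltn_trans xy.
  by move: ys; rewrite path_sortedE => [/andP[/allP/(_ _ zs)]|? ? ? /= h1 h2] //; lia.
rewrite (all_filterP sx) (_ : [seq z <- s | x <= z] = [::]) //.
by apply/eqP; rewrite -[_ == _]negbK -has_filter; apply/hasPn=> z /(allP sx); lia.
Qed.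

Lemma geq_trans : transitive geq.
Proof. by move=> ? ? ? /= h1 h2; lia. Qed.

Lemma geq_anti : antisymmetric geq.
Proof. by move=> ? ? /=; lia. Qed.

(* By strong induction on x: once the parts below x agree, the multiplicity of x
   in kprods determines its multiplicity in the list, because the coefficient
   'C(_, k) of count_kprods_cat is nonzero. *)
Lemma kprods_inj k la mu : sorted geq la -> sorted geq mu ->
  all (leq 1) la -> all (leq 1) mu ->
  count_mem 1 la = count_mem 1 mu -> k <= count_mem 1 la ->
  perm_eq (kprods k.+1 la) (kprods k.+1 mu) -> la = mu.
Proof.
move=> sla smu la0 mu0 e1 ka e.
have c0 l : all (leq 1) l -> count_mem 0 l = 0.
  move=> l0; apply/eqP; rewrite -leqn0 leqNgt -has_count.
  by apply/hasPn=> z /(allP l0) /=; lia.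
suff h x : count_mem x la = count_mem x mu.
  apply: (sorted_eq geq_trans geq_anti) => //.
  by apply/allP=> x _; rewrite /= h.
elim/ltn_ind: x => x IHx.
case: (ltngtP x 1) => x1; last by rewrite x1.
  by rewrite (_ : x = 0) ?c0 //; lia.
have ec : [seq y <- la | y < x] = [seq y <- mu | y < x].
  apply: (sorted_eq geq_trans geq_anti).
  - exact: sorted_filter geq_trans _ _ sla.
  - exact: sorted_filter geq_trans _ _ smu.
  apply/allP=> z _ /=; rewrite !count_filter; case: (ltnP z x) => zx.
    have cz l : count (predI (pred1 z) (fun y => y < x)) l = count_mem z l.
      by apply: eq_count => y /=; case: eqP => //= ->.
    by rewrite !cz IHx.
  by rewrite !(eq_count (a2 := pred0)) ?count_pred0 // => y /=; case: eqP => //= ->; lia.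
have cx l : count_mem x [seq y <- l | x <= y] = count_mem x l.
  by rewrite count_filter; apply: eq_count => y /=; case: eqP => //= ->; rewrite leqnn.
have c1 l : count_mem 1 [seq y <- l | y < x] = count_mem 1 l.
  by rewrite count_filter; apply: eq_count => y /=; case: eqP => //= ->.
have := permP e (pred1 x); rewrite (sorted_geq_split x sla) (sorted_geq_split x smu).
rewrite !count_kprods_cat ?filter_all // -ec => /addIn /eqP.
rewrite eqn_pmul2l ?bin_gt0 ?c1 // !cx => /eqP exx.
by rewrite !count_cat !cx exx.
Qed.

Definition partseq n : seq (seq nat) := fset_set (partitions n).

Lemma partseq_uniq n : uniq (partseq n).
Proof. exact: fset_uniq. Qed.

Lemma mem_partseq n la : (la \in partseq n) = is_partition n la.
Proof.
have /(_ la) := in_fset_set (finite_partitions n); rewrite /partseq => ->.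
by rewrite mem_setE.
Qed.

Lemma ltn_bin2l k a b : k <= a < b -> 'C(a, k.+1) < 'C(b, k.+1).
Proof.
case: b => [|b] /andP[ka ab]; first by rewrite ltn0 in ab.
have := leq_bin2l k.+1 (ab : a <= b); rewrite binS.
have : 0 < 'C(b, k) by rewrite bin_gt0; lia.
lia.
Qed.

(** With [m] ones in the partition, 1 has multiplicity ['C(m, k.+1)] in the image. This is strictly
    increasing in [m] from [k] on, so it determines [m], and [kprods_inj] applies. *)
Lemma pre_inj k n la mu : is_partition n la -> is_partition n mu ->
  k <= count_mem 1 la -> k <= count_mem 1 mu ->
  pre k.+1 la = pre k.+1 mu -> la = mu.
Proof.
move=> /and3P[sla la0 _] /and3P[smu mu0 _] kla kmu e.
have ep : perm_eq (kprods k.+1 la) (kprods k.+1 mu).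
  by rewrite -(permPl (pre_kprods _ _)) e pre_kprods.
have ec : 'C(count_mem 1 la, k.+1) = 'C(count_mem 1 mu, k.+1).
  by rewrite -!count1_kprods (permP ep).
apply: (kprods_inj (k := k)) => //.
case: (ltngtP (count_mem 1 la) (count_mem 1 mu)) => // h.
  by have := @ltn_bin2l k _ _ (introT andP (conj kla h)); rewrite ec ltnn.
by have := @ltn_bin2l k _ _ (introT andP (conj kmu h)); rewrite ec ltnn.
Qed.

(** * Partitions containing a given multiset *)

Lemma perm_cat_exists (T : eqType) (s l : seq T) :
  (forall x, count_mem x s <= count_mem x l) -> exists r, perm_eq (s ++ r) l.
Proof.
elim: s l => [|y s IHs] l h; first by exists l.
have yl : y \in l.
  by rewrite -has_pred1 has_count; apply: leq_trans (h y); rewrite /= eqxx.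
have pl := perm_to_rem yl.
case: (IHs (rem y l)) => [x|r pr].
  by have := h x; rewrite (permP pl) /= leq_add2l.
by exists r; rewrite perm_sym (permPl pl) perm_sym /= perm_cons.
Qed.

Lemma geq_total : total geq.
Proof. by move=> ? ? /=; lia. Qed.

(* Adjoining the multiset s is a bijection from the partitions of n - sumn s
   to the partitions of n that contain s. *)
Lemma count_partseq_supermultiset n (s : seq nat) (P : pred (seq nat)) :
  all (leq 1) s ->
  (forall la, P la <-> forall x, count_mem x s <= count_mem x la) ->
  count P (partseq n) = num_partitions (n%:Z - (sumn s)%:Z)%R.
Proof.
move=> s0 PE; case: (leqP (sumn s) n) => sn; last first.
  (* No partition of [n] contains a multiset of larger sum, which matches the value 0 of
     [num_partitions] at negative integers. *)
  rewrite (_ : (n%:Z - (sumn s)%:Z)%R = Negz (sumn s - n).-1); last by lia.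
  apply/eqP; rewrite -leqn0 leqNgt -has_count; apply/hasPn=> la.
  rewrite mem_partseq => /and3P[_ _ /eqP sla]; apply/negP=> /PE /perm_cat_exists[r].
  by move/perm_sumn; rewrite sumn_cat; lia.
rewrite (_ : (n%:Z - (sumn s)%:Z)%R = Posz (n - sumn s)); last by lia.
rewrite /= -[RHS]/(size (partseq (n - sumn s))).
pose h (mu : seq nat) := sort geq (s ++ mu).
have ph mu : perm_eq (h mu) (s ++ mu) by exact/permPl/perm_sort.
rewrite -(size_map h) -size_filter; apply: perm_size; apply: uniq_perm.
- exact/filter_uniq/partseq_uniq.
- rewrite map_inj_in_uniq ?partseq_uniq // => mu nu.
  rewrite !mem_partseq => /and3P[smu _ _] /and3P[snu _ _] e.
  apply: (sorted_eq geq_trans geq_anti) => //.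
  by rewrite -(perm_cat2l s) -(permPl (ph mu)) e ph.
move=> la; rewrite mem_filter mem_partseq; apply/idP/mapP.
  case/andP=> /PE /perm_cat_exists[r pr] /and3P[sla la0 /eqP ela].
  exists (sort geq r).
    rewrite mem_partseq /is_partition sort_sorted; last exact: geq_total.
    rewrite (perm_all _ (permEl (perm_sort _ _))) (perm_sumn (permEl (perm_sort _ _))).
    move: la0; rewrite -(perm_all _ pr) all_cat => /andP[_ ->] /=.
    by rewrite -ela -(perm_sumn pr) sumn_cat addKn.
  apply: (sorted_eq geq_trans geq_anti) => //; first exact/sort_sorted/geq_total.
  rewrite perm_sym (permPl (ph _)) -(permPr pr) perm_cat2l.
  exact/permPl/perm_sort.
case=> mu; rewrite mem_partseq => /and3P[smu mu0 /eqP emu] ->.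
apply/andP; split.
  by apply/PE => x; rewrite (permP (ph _)) count_cat leq_addr.
rewrite /is_partition sort_sorted; last exact: geq_total.
rewrite (perm_all _ (ph _)) all_cat s0 mu0 (perm_sumn (ph _)) sumn_cat emu.
by rewrite subnKC ?eqxx.
Qed.

(** * Sums of binomials over partitions *)

Lemma bin_hockey_stick n a k : a <= n ->
  'C(a, k.+1) = \sum_(1 <= i < n.+1) 'C(i - 1, k) * (i <= a).
Proof.
move=> an; rewrite big_add1 /= -{1}(minn_idPr an); elim: n {an} => [|n IHn].
  by rewrite min0n big_geq.
rewrite big_nat_recr //= -IHn subn1 /=.
case: (ltnP n a) => na; last by rewrite muln0 addn0; congr 'C(_, _); lia.
by rewrite muln1 (_ : minn n.+1 a = n.+1) ?(_ : minn n a = n) ?binS //; lia.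
Qed.

(** Gives one cut-off [n] for all sums over multiplicities, so that they can be exchanged with the
    sum over partitions. *)
Lemma count_mem_partseq n la x : la \in partseq n -> count_mem x la <= n.
Proof.
rewrite mem_partseq => /and3P[_ la0 /eqP <-].
elim: la la0 => //= y s IHs /andP[y0 /IHs h]; apply: leq_add => //.
by case: eqP => //=.
Qed.

Lemma sum_bin_partseq n k :
  \sum_(la <- partseq n) 'C(count_mem 1 la, k.+1) =
  \sum_(1 <= i < n.+1) 'C(i - 1, k) * num_partitions (n%:Z - i%:Z)%R.
Proof.
transitivity (\sum_(la <- partseq n) \sum_(1 <= i < n.+1)
    'C(i - 1, k) * (i <= count_mem 1 la)).
  apply: eq_big_seq => la hla; apply: bin_hockey_stick; exact: count_mem_partseq hla.
rewrite exchange_big /=; apply: eq_big_nat => i /andP[i0 _].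
rewrite -big_distrr /=; congr muln.
have := @count_partseq_supermultiset n (nseq i 1) (fun la => i <= count_mem 1 la).
rewrite sumn_nseq mul1n => <-.
- by rewrite -sum1_count [RHS]big_mkcond; apply: eq_bigr => la _; case: ifP.
- by apply/allP=> x /nseqP[->].
move=> la; split=> [h x|/(_ 1)]; rewrite count_nseq /=; last by rewrite mul1n.
by case: eqP => [<-|//]; rewrite mul1n.
Qed.

Lemma sum_bin_mul_partseq n k p : 1 < p ->
  \sum_(la <- partseq n) 'C(count_mem 1 la, k.+1) * count_mem p la =
  \sum_(1 <= i < n.+1) \sum_(1 <= j < n.+1)
    'C(i - 1, k) * num_partitions (n%:Z - i%:Z - p%:Z * j%:Z)%R.
Proof.
move=> p1; transitivity (\sum_(la <- partseq n) \sum_(1 <= i < n.+1)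
    \sum_(1 <= j < n.+1)
    'C(i - 1, k) * ((i <= count_mem 1 la) * (j <= count_mem p la))).
  apply: eq_big_seq => la hla.
  rewrite (bin_hockey_stick k (count_mem_partseq 1 hla)) big_distrl /=.
  apply: eq_bigr => i _.
  (* The factor [count_mem p la] is a binomial ['C(_, 1)], so the same expansion applies, with all
     coefficients ['C(j - 1, 0)] equal to 1. *)
  rewrite -[X in _ * X = _]bin1 (bin_hockey_stick 0 (count_mem_partseq p hla)).
  rewrite big_distrr /=.
  by apply: eq_bigr => j _; rewrite bin0 mul1n mulnA.
rewrite exchange_big /=; apply: eq_big_nat => i /andP[i0 _].
rewrite exchange_big /=; apply: eq_big_nat => j /andP[j0 _].
rewrite -big_distrr /=; congr muln.
have := @count_partseq_supermultiset n (nseq i 1 ++ nseq j p)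
  (fun la => (i <= count_mem 1 la) && (j <= count_mem p la)).
rewrite sumn_cat !sumn_nseq mul1n.
rewrite (_ : (n%:Z - (i + p * j)%N%:Z)%R = (n%:Z - i%:Z - p%:Z * j%:Z)%R); last by lia.
move=> <-.
- rewrite -sum1_count [RHS]big_mkcond.
  by apply: eq_bigr => la _; rewrite mulnb; case: (_ && _).
- by rewrite all_cat; apply/andP; split; apply/allP=> x /nseqP[-> _] //; lia.
(* As [p] differs from 1, the ones and the copies of [p] are counted separately. *)
have p1' : (p == 1) = false by lia.
move=> la; split=> [/andP[h1 hp] x|h]; last first.
  have := h 1; have := h p; rewrite !count_cat !count_nseq /= !eqxx p1'.
  by rewrite [1 == p]eq_sym p1' !mul1n !mul0n addn0 add0n => -> ->.
rewrite count_cat !count_nseq /=.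
case: (eqVneq 1 x) => [<-|x1]; first by rewrite p1' mul1n addn0.
by case: eqP => [<-|//]; rewrite mul1n.
Qed.

(** * From sums over images to sums over partitions *)

(** The hypothesis places every contributing [la] where [pre k.+1] is injective, so the sum over
    images becomes a sum over the set [D] of these [la]; all other terms are 0. *)
Lemma a_kprods i k n :
  (forall la, is_partition n la -> count_mem i (kprods k.+1 la) != 0 ->
     k <= count_mem 1 la) ->
  a_ i k.+1 n = \sum_(la <- partseq n) count_mem i (kprods k.+1 la).
Proof.
move=> hi.
pose D := [set la | is_partition n la /\ count_mem i (kprods k.+1 la) != 0].
have cp la : mult (pre k.+1 la) i = count_mem i (kprods k.+1 la).
  exact/permP/pre_kprods.
(* A short list has no products, so members of [D] have the [k.+1] parts that [pre_set] requires. *)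
have hsz la : count_mem i (kprods k.+1 la) != 0 -> k < size la.
  by rewrite ltnNge; apply: contraNN => sz; rewrite kprods_nil.
transitivity (\big[addn/0]_(nu \in pre k.+1 @` D) mult nu i).
  apply/esym; apply: fsbig_widen => [_ [la [pla h] <-]|_ [[la [pla _] <-] /= nD]].
    by exists la => //; split=> //; exact: hsz.
  rewrite cp; apply/eqP/negP=> /negP h; apply: nD; exists la => //.
rewrite fsbig_image; last first.
  move=> la mu; rewrite !inE => -[pla la0] [pmu mu0].
  by apply: (pre_inj pla pmu); exact: hi.
rewrite -[RHS]/(\sum_(la <- fset_set (partitions n)) _).
rewrite -(fsbig_finite _ _ (finite_partitions n)).
transitivity (\big[addn/0]_(la \in D) count_mem i (kprods k.+1 la)).
  by apply: eq_fsbigr => la _; rewrite cp.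
apply: fsbig_widen => [la []//|la [/= pla nD]].
by apply/eqP/negP=> /negP h; apply: nD.
Qed.

Theorem theorem3p3 (k n p : nat) (hk : 2 <= k) (hp : prime p) :
  a_ 1 k n =
    \big[addn/0]_(i \in [set i : nat | 1 <= i])
      ('C(i - 1, k - 1) * num_partitions (n%:Z - i%:Z)%R)
  /\
  a_ p k n =
    \big[addn/0]_(ij \in [set ij : nat * nat | 1 <= ij.1 /\ 1 <= ij.2])
      ('C(ij.1 - 1, k - 2) *
         num_partitions (n%:Z - ij.1%:Z - p%:Z * ij.2%:Z)%R).
Proof.
have num0 (z : int) : (z < 0)%R -> num_partitions z = 0 by case: z.
(* From here [k] stands for the original value minus 2. *)
case: k hk => [|[|k]] // _; rewrite !subSS !subn0; split.
  rewrite a_kprods; last first.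
    by move=> la _; rewrite count1_kprods -lt0n bin_gt0; lia.
  under eq_bigr do rewrite count1_kprods.
  rewrite sum_bin_partseq fsbig_seq ?iota_uniq //.
  (* The infinite sum adds only indices [i > n], where [n - i] is negative and the term is 0. *)
  apply: fsbig_widen => [i|i [/= i0 ni]]; first by rewrite /= mem_index_iota => /andP[].
  by rewrite num0 ?muln0 //; move/negP: ni; rewrite mem_index_iota; lia.
rewrite a_kprods; last first.
  by move=> la _; rewrite count_prime_kprods // muln_eq0 negb_or -lt0n bin_gt0 => /andP[].
under eq_bigr do rewrite count_prime_kprods //.
rewrite sum_bin_mul_partseq ?prime_gt1 //.
rewrite -(@big_allpairs _ _ _ _ _ _ _ (fun ij => 'C(ij.1 - 1, k) *
   num_partitions (n%:Z - ij.1%:Z - p%:Z * ij.2%:Z)%R)).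
have p0 := prime_gt0 hp.
rewrite fsbig_seq; last by apply: allpairs_uniq; rewrite ?iota_uniq // => -[? ?] [? ?].
apply: fsbig_widen => [[i j]|[i j] [/= [i0 j0] ni]].
  by move=> /allpairsP[[a b] /= [+ + [-> ->]]]; rewrite !mem_index_iota => /andP[? _] /andP[].
(* If [i] or [j] exceeds [n], then [n - i - p * j] is negative because [p] is positive. *)
case: (boolP ((i <= n) && (j <= n))) => ijn; last by rewrite num0 ?muln0 //; nia.
case: ni; apply/allpairsP; exists (i, j).
by split=> //=; rewrite mem_index_iota; lia.
Qed.
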